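(* Let $n\ge 3$ with $n\neq 4$, and let $2\le k<n$. Then $$\operatorname{Det}(\mathrm{PX}(n,k))=\begin{cases}\lceil n/k\rceil, & \text{if } k\neq n/2,\\ \lceil n/k\rceil+1=3, & \text{if } k=n/2.\end{cases}$$
   Context: For integers $n\ge 3$ and $1\le k<n$, the Praeger–Xu graph $\mathrm{PX}(n,k)$ is the simple graph with vertex set $\mathbb Z_n\times\mathbb Z_2^k$; a vertex is written $(i,x)$ with $x=x_0x_1\cdots x_{k-1}$ a bitstring of length $k$. Two vertices $(i,x)$ and $(j,y)$ are adjacent if and only if (after possibly swapping the two vertices) $j=i+1$ in $\mathbb Z_n$ and $x=az_1\cdots z_{k-1}$, $y=z_1\cdots z_{k-1}b$ for some bits $a,b,z_1,\dots,z_{k-1}\in\mathbb Z_2$. For a graph $G$, a set $S\subseteq V(G)$ is a determining set if the only automorphism of $G$ fixing every vertex of $S$ is the identity; $\operatorname{Det}(G)$ is the minimum size of a determining set. *)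

(* Defs.v *)
From HB Require Import structures.
From mathcomp Require Import all_boot all_order all_fingroup all_algebra.

Set Implicit Arguments.
Unset Strict Implicit.
Unset Printing Implicit Defensive.

Import GRing.Theory.

Local Open Scope ring_scope.

(* A graph on a finite type of vertices is given by its adjacency relation. *)
Section DeterminingNumber.
Variables (V : finType) (adj : rel V).

Definition graph_automorphism (s : {perm V}) : bool :=
  [forall u, forall v, adj (s u) (s v) == adj u v].

Definition determining (S : {set V}) : bool :=
  [forall s : {perm V},
     graph_automorphism s && [forall v in S, s v == v] ==> (s == 1%g)].

Lemma determiningT : determining [set: V].
Proof.
apply/forallP => s; apply/implyP => /andP[_ /forall_inP fix_s].
by apply/eqP/permP => v; rewrite perm1; apply/eqP/fix_s; rewrite inE.
Qed.

(* The whole vertex set is determining, so the minimum is attained. *)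
Definition Det : nat := #|[arg min_(S < [set: V] | determining S) #|S|]|.

Lemma DetP : exists2 S : {set V}, determining S &
  Det = #|S| /\ forall S' : {set V}, determining S' -> (#|S| <= #|S'|)%N.
Proof.
by rewrite /Det; case: arg_minnP => [|S detS minS]; [exact: determiningT | exists S].
Qed.

End DeterminingNumber.

(* 'Z_n is the ring of integers modulo n only for n >= 2; the strings          *)
(* a z_1 ... z_(k-1) and z_1 ... z_(k-1) b have length k only for k >= 1.      *)
Definition PX_vertex (n k : nat) : finType := ('Z_n * k.-tuple bool)%type.

Definition PX_arc (n k : nat) (u v : PX_vertex n k) : bool :=
  (v.1 == u.1 + 1) &&
  [exists a : bool, exists b : bool, exists z : k.-1.-tuple bool,
     (u.2 == a :: z :> seq bool) && (v.2 == rcons z b :> seq bool)].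

Definition PX (n k : nat) : rel (PX_vertex n k) :=
  fun u v => PX_arc u v || PX_arc v u.
Arguments PX : clear implicits.

Lemma PX_sym (n k : nat) : symmetric (PX n k).
Proof. by move=> u v; rewrite /PX orbC. Qed.

Lemma PX_irrefl (n k : nat) : irreflexive (PX n k).
Proof.
by move=> u; rewrite /PX /PX_arc -{1 3}[u.1]addr0 (inj_eq (addrI _)) eq_sym oner_eq0.
Qed.

(* Main.v *)
(* Read a vertex (i, x) as an assignment of the bits x_0, ..., x_(k-1) to the
   positions i, ..., i+k-1 of Z_n: adjacent vertices have intervals shifted by one
   and agree on the overlap. Flipping the bit at one position is an automorphism,
   so the intervals of a determining set cover Z_n, which needs ceil(n/k) of them.
   Conversely, when n <> 4 a directed path of length 2 has no other path with the
   same ends, while two neighbours of a vertex on the same side always have a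
   second common neighbour; hence an automorphism preserves all arcs or reverses
   all arcs. If it preserves arcs and fixes a vertex, it shifts no interval and
   transports bits along walks, so it fixes every bit at a position covered by a
   fixed vertex. If it reverses arcs, then i |-> c - i on first coordinates, so it
   cannot fix vertices over i and j with 2i <> 2j. The multiples of k, one for each
   vertex, meet both conditions unless n = 2k; in that case 1 has to be added,
   because a reflection composed with flips fixes any two opposite vertices. *)
Require Import Defs.
From mathcomp Require Import all_boot all_order all_fingroup all_algebra.
From mathcomp Require Import ring.

Set Implicit Arguments.
Unset Strict Implicit.
Unset Printing Implicit Defensive.

Import Order.TTheory GRing.Theory Num.Theory.

Local Open Scope ring_scope.

Lemma natr_Zp_eq0 (n m : nat) : (1 < n)%N -> (m%:R == 0 :> 'Z_n) = (n %| m)%N.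
Proof. by move=> n1; rewrite -val_eqE /= val_Zp_nat. Qed.

Lemma val_Zp_lt (n : nat) (p : 'Z_n) : (1 < n)%N -> (val p < n)%N.
Proof. by move=> n1; have := ltn_ord p; rewrite [X in (_ < X)%N]Zp_cast. Qed.

(** * Automorphisms and determining sets of an arbitrary graph *)

Section Automorphisms.
Variables (V : finType) (adj : rel V).

Lemma automorphismP (s : {perm V}) :
  reflect (forall u v, adj (s u) (s v) = adj u v) (graph_automorphism adj s).
Proof.
apply: (iffP forallP) => [aut_s u v | aut_s u].
  by have /forallP/(_ v)/eqP := aut_s u.
by apply/forallP => v; rewrite aut_s.
Qed.

Lemma automorphismM (s t : {perm V}) :
  graph_automorphism adj s -> graph_automorphism adj t ->
  graph_automorphism adj (s * t).
Proof.
by move=> /automorphismP s_aut /automorphismP t_aut; apply/automorphismP => u v;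
  rewrite !permM t_aut s_aut.
Qed.

Lemma automorphismV (s : {perm V}) :
  graph_automorphism adj s -> graph_automorphism adj s^-1.
Proof.
move=> /automorphismP s_aut; apply/automorphismP => u v.
by rewrite -s_aut !permKV.
Qed.

Lemma determiningP (S : {set V}) :
  reflect (forall s : {perm V}, graph_automorphism adj s ->
             {in S, forall v, s v = v} -> s = 1%g)
          (determining adj S).
Proof.
apply: (iffP forallP) => [det s s_aut s_fix | det s].
  apply/eqP; apply: (implyP (det s)); rewrite s_aut.
  by apply/forall_inP => v /s_fix ->.
apply/implyP => /andP[s_aut /forall_inP s_fix]; apply/eqP/det => // v vS.
exact/eqP/s_fix.
Qed.

Lemma Det_le (S : {set V}) : determining adj S -> (Det adj <= #|S|)%N.
Proof. by move=> detS; have [T _ [-> minT]] := DetP adj; exact: minT. Qed.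

Lemma leq_Det (m : nat) :
  (forall S : {set V}, determining adj S -> m <= #|S|)%N -> (m <= Det adj)%N.
Proof. by move=> le_m; have [T detT [-> _]] := DetP adj; exact: le_m. Qed.

End Automorphisms.

(** * Vertices, arcs and walks of the Praeger-Xu graph *)

Section PraegerXu.
Variables n k : nat.
Hypotheses (n_ge3 : (3 <= n)%N) (k_gt1 : (1 < k)%N).

Local Notation V := (PX_vertex n k).
Local Notation arc := (@PX_arc n k).
Local Notation bit u j := (nth false (tval (snd u)) j).

Let n_gt1 : (1 < n)%N. Proof. exact: ltnW. Qed.
Let k_gt0 : (0 < k)%N. Proof. exact: ltnW. Qed.

Lemma vertex_ext (u v : V) :
  u.1 = v.1 -> (forall j, (j < k)%N -> bit u j = bit v j) -> u = v.
Proof.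
case: u v => [i x] [i' y] /= -> xy; congr pair; apply/val_inj.
apply: (@eq_from_nth _ false) => [|j]; rewrite !size_tuple //; exact: xy.
Qed.

Lemma arcP (u v : V) :
  reflect (v.1 = u.1 + 1 /\
           forall j, (j.+1 < k)%N -> bit u j.+1 = bit v j)
          (arc u v).
Proof.
apply: (iffP andP) => [[/eqP -> H]|[-> uv]].
  split=> // j jk; case/existsP: H => a /existsP[b /existsP[z]].
  move=> /andP[/eqP -> /eqP ->] /=.
  by rewrite nth_rcons size_tuple ltn_predRL jk.
split=> //; apply/existsP; exists (bit u 0); apply/existsP; exists (bit v k.-1).
have sz : size (behead u.2) == k.-1 by rewrite size_behead size_tuple.
apply/existsP; exists (Tuple sz); apply/andP; split; apply/eqP => /=.
  by move: k_gt0; rewrite -{1}(size_tuple u.2); case: (tval _).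
apply: (@eq_from_nth _ false) => [|j].
  by rewrite size_rcons size_behead !size_tuple prednK.
rewrite size_tuple => jk; rewrite nth_rcons (eqP sz) nth_behead.
rewrite ltn_predRL; case: ltnP => [/uv -> //|].
move=> kj; have -> : j = k.-1; last by rewrite eqxx.
by apply/eqP; rewrite eqn_leq -ltnS prednK // jk -ltnS prednK.
Qed.

Definition vertex (i : 'Z_n) (f : nat -> bool) : V :=
  (i, [tuple f (val j) | j < k]).

Lemma bit_vertex i f j : (j < k)%N -> bit (vertex i f) j = f j.
Proof. by move=> jk; rewrite -[j]/(val (Ordinal jk)) -tnth_nth tnth_mktuple. Qed.

Lemma eq_vertex i i' f g :
  i = i' -> (forall j, (j < k)%N -> f j = g j) -> vertex i f = vertex i' g.
Proof. by move=> -> fg; apply: vertex_ext => // j jk; rewrite !bit_vertex ?fg. Qed.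

Lemma vertexE (u : V) : vertex u.1 (fun j => bit u j) = u.
Proof. by apply: vertex_ext => // j jk; rewrite bit_vertex. Qed.

(** A window of length [k] sliding along the bit stream [f]. The stream is indexed by time, not by
    ['Z_n], so a walk may go round the cycle and meet new bits. *)
Definition walk (f : nat -> bool) (i : 'Z_n) (t : nat) : V :=
  vertex (i + t%:R) (fun j => f (t + j)%N).

Lemma walk_arc f i t : arc (walk f i t) (walk f i t.+1).
Proof.
apply/arcP; split=> [|j jk]; first by rewrite /= -addrA natr1.
by rewrite /walk (bit_vertex _ _ jk) (bit_vertex _ _ (ltnW jk)) addnS addSn.
Qed.

Lemma walk0 (u : V) (f : nat -> bool) :
  (forall j, (j < k)%N -> f j = bit u j) -> walk f u.1 0 = u.
Proof. by move=> fu; rewrite -[RHS]vertexE; apply: eq_vertex; rewrite ?addr0. Qed.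

(* Since the walk is longer than [k], its first and last [k] bits are independent. *)
Lemma walk_connect (u v : V) : exists f t, walk f u.1 0 = u /\ walk f u.1 t.+1 = v.
Proof.
(* The summand [n * k] vanishes in ['Z_n] and makes [d] at least [k]. *)
pose d := (val (v.1 - u.1)%R + n * k)%N.
have kd : (k <= d)%N by rewrite (leq_trans _ (leq_addl _ _)) // leq_pmull // ltnW.
exists (fun j => if (j < k)%N then bit u j else bit v (j - d)%N), d.-1.
rewrite prednK; last exact: leq_trans kd.
split; first by apply: walk0 => j ->.
rewrite -[RHS]vertexE; apply: eq_vertex => [|j jk].
  rewrite natrD natr_Zp natrM pchar_Zp // mul0r addr0; exact: subrKC.
by rewrite ltnNge (leq_trans kd (leq_addr _ _)) addKn.
Qed.

Lemma arc_asym (u v : V) : arc u v -> ~~ arc v u.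
Proof.
move=> /arcP[v1 _]; apply/negP => /arcP[/eqP].
rewrite v1 -addrA -subr_eq0 opprD addNKr oppr_eq0 -(natrD _ 1 1) natr_Zp_eq0 //.
by rewrite gtnNdvd.
Qed.

(** The last bit of [b] is outside the overlap with any in-neighbour, so it can be flipped. *)
Lemma two_in_arcs (a a' b : V) : arc a b -> arc a' b ->
  exists2 b', b' != b & arc a b' && arc a' b'.
Proof.
pose b' := vertex b.1 (fun j => bit b j (+) (j == k.-1)).
have out c : arc c b -> arc c b'.
  move=> /arcP[b1 cb]; apply/arcP; split=> // j jk.
  rewrite bit_vertex 1?ltnW // cb //.
  by rewrite [j == _]ltn_eqF ?addbF // -ltnS prednK.
move=> /out ab /out a'b; exists b'; last by rewrite ab.
apply/eqP => /(congr1 (fun u : V => bit u k.-1)).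
by rewrite bit_vertex ?ltn_predL // eqxx addbT; case: (nth _ _ _).
Qed.

Lemma two_out_arcs (a b b' : V) : arc a b -> arc a b' ->
  exists2 a', a' != a & arc a' b && arc a' b'.
Proof.
pose a' := vertex a.1 (fun j => bit a j (+) (j == 0)%N).
have out c : arc a c -> arc a' c.
  move=> /arcP[c1 ac]; apply/arcP; split=> // j jk.
  by rewrite bit_vertex // addbF ac.
move=> /out ab /out ab'; exists a'; last by rewrite ab.
apply/eqP => /(congr1 (fun u : V => bit u 0)).
by rewrite bit_vertex // eqxx addbT; case: (nth _ _ _).
Qed.

(** * Orientation: automorphisms and the direction of arcs *)

Section NotFour.
Hypothesis n_neq4 : n <> 4%N.

(** Any other choice of directions at [w] would displace by 0 or -2 instead of 2, forcing 2 = 0 or 4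
    = 0 in ['Z_n]. *)
Lemma middle_unique (a b c w : V) :
  arc a b -> arc b c -> PX n k a w -> PX n k w c -> w = b.
Proof.
move=> /arcP[b1 ab] /arcP[c1 bc] aw wc.
have two0 : (2%:R == 0 :> 'Z_n) = false by rewrite natr_Zp_eq0 ?gtnNdvd.
have four0 : (4%:R == 0 :> 'Z_n) = false.
  rewrite natr_Zp_eq0 //; apply/negP => /dvdnP[[|[|q]]] // e4.
    by case: n_neq4; rewrite e4 mul1n.
  have := leq_mul (isT : (2 <= q.+2)%N) n_ge3; by rewrite -e4.
have no_shift m (x : 'Z_n) : (m%:R == 0 :> 'Z_n) = false -> x + m%:R <> x.
  by move=> m0 /eqP; rewrite -subr_eq0 addrAC subrr add0r m0.
have {}aw : arc a w.
  case/orP: aw => // /arcP[a1 _]; case/orP: wc => /arcP[e _].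
    by case: (no_shift 2 (w.1 + 1) two0); rewrite -[RHS]e c1 b1 a1; ring.
  by case: (no_shift 4 w.1 four0); rewrite [RHS]e c1 b1 a1; ring.
have {}wc : arc w c.
  case/orP: wc => // /arcP[w1 _]; case/arcP: aw => e _.
  by case: (no_shift 2 (a.1 + 1) two0); rewrite -[RHS]e w1 c1 b1; ring.
case/arcP: aw wc => w1 aw /arcP[_ wc]; apply: vertex_ext; first by rewrite w1 b1.
(* Bit 0 is read off [a], which uses [1 < k]; all later bits are read off [c]. *)
by case=> [|j] jk; [rewrite -aw // -ab | rewrite wc // bc].
Qed.

Section Orientation.
Variable s : {perm V}.
Hypothesis s_aut : graph_automorphism (PX n k) s.

Let sE u v : PX n k (s u) (s v) = PX n k u v.
Proof. exact/automorphismP. Qed.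

(** If [s] turned the directed path into two in-arcs or two out-arcs at [s v], then [s u] and [s w]
    would have a second common neighbour, against [middle_unique]. *)
Lemma arc_orientation_step (u v w : V) :
  arc u v -> arc v w -> arc (s u) (s v) = arc (s v) (s w).
Proof.
move=> uv vw.
have unique y : PX n k (s u) y -> PX n k y (s w) -> y = s v.
  rewrite -[y](permKV s) !sE => uy yw; congr (s _).
  exact: middle_unique uv vw uy yw.
have: PX n k (s u) (s v) by rewrite sE /PX uv.
have: PX n k (s v) (s w) by rewrite sE /PX vw.
case/orP=> [svw|swv] /orP[suv|svu].
- by rewrite suv svw.
- have [y /eqP yv /andP[yu yw]] := two_out_arcs svu svw.
  by case: yv; apply: unique; rewrite /PX ?yu ?yw ?orbT.
- have [y /eqP yv /andP[uy wy]] := two_in_arcs suv swv.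
  by case: yv; apply: unique; rewrite /PX ?uy ?wy ?orbT.
- by rewrite (negPf (arc_asym svu)) (negPf (arc_asym swv)).
Qed.

Lemma arc_orientation_const (u v u' v' : V) :
  arc u v -> arc u' v' -> arc (s u) (s v) = arc (s u') (s v').
Proof.
move=> uv u'v'; have [f [t [w0 wt]]] := walk_connect v u'.
have step i : arc (s (walk f v.1 i)) (s (walk f v.1 i.+1)) = arc (s u) (s v).
  elim: i => [|i IHi]; last by rewrite -IHi; apply/esym/arc_orientation_step/walk_arc/walk_arc.
  by rewrite -[in RHS]w0; apply/esym/arc_orientation_step/walk_arc; rewrite w0.
rewrite -(step t) wt; apply: arc_orientation_step => //.
by rewrite -wt; exact: walk_arc.
Qed.

Lemma orientation :
  (forall u v, arc u v -> arc (s u) (s v)) \/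
  (forall u v, arc u v -> arc (s v) (s u)).
Proof.
have w01 := walk_arc xpred0 0 0.
case e: (arc (s (walk xpred0 0 0)) (s (walk xpred0 0 1))); [left|right] => u v uv.
  by rewrite (arc_orientation_const uv w01).
have: PX n k (s u) (s v) by rewrite sE /PX uv.
by rewrite /PX (arc_orientation_const uv w01) e.
Qed.

End Orientation.

Lemma arc_preserving_shift (s : {perm V}) (u v : V) :
  (forall u v, arc u v -> arc (s u) (s v)) -> (s u).1 - u.1 = (s v).1 - v.1.
Proof.
move=> s_arc; have [f [t [w0 wt]]] := walk_connect u v; rewrite -wt -[in LHS]w0.
have shift (x y : 'Z_n) : x + 1 - (y + 1) = x - y.
  by rewrite opprD addrACA subrr addr0.
elim: t.+1 => // i ->; case/arcP: (walk_arc f u.1 i) => -> _.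
by case/arcP: (s_arc _ _ (walk_arc f u.1 i)) => -> _; rewrite shift.
Qed.

Lemma arc_reversing_shift (s : {perm V}) (u v : V) :
  (forall u v, arc u v -> arc (s v) (s u)) -> (s u).1 + u.1 = (s v).1 + v.1.
Proof.
move=> s_arc; have [f [t [w0 wt]]] := walk_connect u v; rewrite -wt -[in LHS]w0.
elim: t.+1 => // i ->; case/arcP: (walk_arc f u.1 i) => -> _.
by case/arcP: (s_arc _ _ (walk_arc f u.1 i)) => -> _; rewrite addrAC [RHS]addrA.
Qed.

(** * Action of arc-preserving automorphisms on bits *)

Section ArcPreserving.
Variable s : {perm V}.
Hypothesis s_arc : forall u v, arc u v -> arc (s u) (s v).

Lemma bit_transport f i t j : (t + j < k)%N ->
  bit (s (walk f i 0)) (t + j) = bit (s (walk f i t)) j.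
Proof.
elim: t j => // t IHt j; rewrite addSnnS => tj; rewrite IHt //.
case/arcP: (s_arc (walk_arc f i t)) => _; apply.
by rewrite (leq_ltn_trans _ tj) // leq_addl.
Qed.

(* Walk forward from [u] until bit [j] comes first; the vertex reached has an
   ancestor [k.-1] steps back whose only possibly nonzero bit is that same bit. *)
Lemma bit_canonical (u : V) j : (j < k)%N ->
  bit (s u) j =
  bit (s (vertex (u.1 + j%:R - k.-1%:R) (fun t => (t == k.-1) && bit u j))) k.-1.
Proof.
move=> jk; pose f := nth false u.2.
pose i := u.1 + j%:R - k.-1%:R.
pose g t := (k.-1 <= t)%N && f (j + (t - k.-1))%N.
transitivity (bit (s (walk f u.1 j)) 0).
  by rewrite -bit_transport ?addn0 ?walk0.
have -> : walk f u.1 j = walk g i k.-1.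
  apply: eq_vertex => [|t tk]; first by rewrite subrK.
  by rewrite /g leq_addr addKn.
rewrite -bit_transport addn0 ?ltn_predL //; congr (bit (s _) _).
apply: eq_vertex => [|t tk]; first by rewrite addr0.
rewrite /g add0n eqn_leq -[(t <= _)%N]ltnS prednK // tk /=.
case: leqP => //= kt; have -> : (t - k.-1)%N = 0%N; last by rewrite addn0.
by apply/eqP; rewrite subn_eq0 -ltnS prednK.
Qed.

(** The vertex in [bit_canonical] depends only on the position and the value of the bit. *)
Lemma bit_shared (u v : V) i j : (i < k)%N -> (j < k)%N ->
  u.1 + i%:R = v.1 + j%:R -> bit u i = bit v j -> bit (s u) i = bit (s v) j.
Proof. by move=> ik jk uv b; rewrite (bit_canonical u ik) (bit_canonical v jk) uv b. Qed.

End ArcPreserving.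

Lemma arc_preservingV (s : {perm V}) : graph_automorphism (PX n k) s ->
  (forall u v, arc u v -> arc (s u) (s v)) ->
  forall u v, arc u v -> arc (s^-1%g u) (s^-1%g v).
Proof.
move=> s_aut s_arc u v uv.
have /automorphismP sE := s_aut.
have: PX n k (s^-1%g u) (s^-1%g v) by rewrite -sE !permKV /PX uv.
by case/orP=> // /s_arc; rewrite !permKV => vu; have := arc_asym uv; rewrite vu.
Qed.

(** The second hypothesis excludes arc-reversing automorphisms; the covering then handles the
    arc-preserving ones. *)
Lemma determining_cover (S : {set V}) :
  (forall p : 'Z_n, exists2 v, v \in S & exists2 j, (j < k)%N & p = v.1 + j%:R) ->
  (exists u v, [/\ u \in S, v \in S & u.1 + u.1 != v.1 + v.1]) ->
  determining (PX n k) S.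
Proof.
move=> cover [u0 [v0 [u0S v0S uv0]]]; apply/determiningP => s s_aut s_fix.
case: (orientation s_aut) => [s_arc|]; last first.
  move=> /(arc_reversing_shift u0 v0); rewrite !s_fix // => e.
  by rewrite e eqxx in uv0.
have s1 u : (s u).1 = u.1.
  have /eqP := arc_preserving_shift u u0 s_arc.
  by rewrite (s_fix u0) // subrr subr_eq0 => /eqP.
apply/permP => u; rewrite perm1; apply: vertex_ext => // j jk.
have [v vS [i ik uv]] := cover (u.1 + j%:R).
have [e|/eqP e] := eqVneq (bit u j) (bit v i).
  by rewrite (bit_shared s_arc jk ik uv e) s_fix // e.
(* If both bits differ from that of [v], they coincide; if only that of [u] does, [bit_shared] for
   the inverse of [s] gives the equality. *)
have [e'|/eqP e'] := eqVneq (bit (s u) j) (bit v i); last first.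
  by move: e e'; case: (bit u j); case: (bit v i); case: (bit (s u) j).
have := @bit_shared _ (arc_preservingV s_aut s_arc) (s u) v j i jk ik.
rewrite s1 permK => /(_ uv e') ->.
by rewrite e' -{2}(s_fix v vS) permK.
Qed.

End NotFour.

(** * Explicit automorphisms: flips and reflections *)

Definition flip_fun (c : 'Z_n -> bool) (u : V) : V :=
  vertex u.1 (fun j => bit u j (+) c (u.1 + j%:R)).

Lemma flip_funK c : involutive (flip_fun c).
Proof.
move=> u; apply: vertex_ext => // j jk.
by rewrite /flip_fun !bit_vertex // addbK.
Qed.

Definition flip c : {perm V} := perm (inv_inj (flip_funK c)).

Lemma flip_aut c : graph_automorphism (PX n k) (flip c).
Proof.
have flip_arc u v : arc u v -> arc (flip_fun c u) (flip_fun c v).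
  move=> /arcP[v1 uv]; apply/arcP; split=> // j jk.
  rewrite /flip_fun (bit_vertex _ _ jk) (bit_vertex _ _ (ltnW jk)) uv // v1.
  by rewrite -addrA nat1r.
have flipE u v : arc (flip_fun c u) (flip_fun c v) = arc u v.
  by apply/idP/idP => /flip_arc; rewrite ?flip_funK.
by apply/automorphismP => u v; rewrite /PX !permE !flipE.
Qed.

(** Position [p] goes to [c + k - 1 - p]; [c] is the reflection constant for starting positions. *)
Definition reflect_fun (c : 'Z_n) (u : V) : V :=
  vertex (c - u.1) (fun j => bit u (k.-1 - j)%N).

Lemma reflect_funK c : involutive (reflect_fun c).
Proof.
move=> u; apply: vertex_ext => [|j jk]; first by rewrite /= subKr.
have jk1 : (j <= k.-1)%N by rewrite -ltnS prednK.
rewrite /reflect_fun !bit_vertex // ?subKn //.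
by rewrite (leq_ltn_trans (leq_subr _ _)) ?ltn_predL.
Qed.

Definition reflection c : {perm V} := perm (inv_inj (reflect_funK c)).

Lemma reflection_aut c : graph_automorphism (PX n k) (reflection c).
Proof.
have refl_arc u v : arc u v -> arc (reflect_fun c v) (reflect_fun c u).
  move=> /arcP[v1 uv]; apply/arcP; split=> [|j jk].
    by rewrite /= v1 opprD addrA subrK.
  have jk1 : (j < k.-1)%N by rewrite ltn_predRL.
  rewrite /reflect_fun (bit_vertex _ _ jk) (bit_vertex _ _ (ltnW jk)) -uv subnSK //.
  by rewrite (leq_ltn_trans (leq_subr _ _)) ?ltn_predL.
have reflE u v : arc (reflect_fun c v) (reflect_fun c u) = arc u v.
  by apply/idP/idP => /refl_arc; rewrite ?reflect_funK.
by apply/automorphismP => u v; rewrite /PX !permE !reflE orbC.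
Qed.

(** * Lower bound from covering *)

Lemma determining_covers (S : {set V}) : determining (PX n k) S ->
  forall p : 'Z_n, exists2 v, v \in S & exists2 j, (j < k)%N & p = v.1 + j%:R.
Proof.
move=> /determiningP detS p.
case: (boolP [exists v in S, exists j : 'I_k, p == v.1 + j%:R]).
  by move=> /exists_inP[v vS /existsP[j /eqP pE]]; exists v => //; exists j.
move=> /exists_inPn uncovered.
(* Flipping the uncovered position fixes [S] but moves any vertex starting there. *)
have /permP/(_ (vertex p xpred0)) : flip (pred1 p) = 1%g.
  apply: detS => [|v vS]; first exact: flip_aut.
  rewrite permE; apply: vertex_ext => // j jk; rewrite bit_vertex //=.
  have /existsPn/(_ (Ordinal jk)) := uncovered v vS.
  by rewrite eq_sym => /negPf ->; rewrite addbF.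
rewrite permE perm1 => /(congr1 (fun u : V => bit u 0)).
by rewrite !bit_vertex //= addr0 eqxx.
Qed.

Lemma determining_card (S : {set V}) :
  determining (PX n k) S -> (n <= #|S| * k)%N.
Proof.
move=> /determining_covers cover.
have cardZ : #|{: 'Z_n}| = n by rewrite card_ord Zp_cast.
rewrite -[leqLHS]cardZ.
rewrite -[X in (_ * X)%N](card_ord k) -[X in (_ * X)%N]cardsT -cardsX.
pose pos (x : V * 'I_k) : 'Z_n := x.1.1 + (val x.2)%:R.
apply: leq_trans (leq_imset_card pos _).
rewrite -cardsT; apply/subset_leq_card/subsetP => p _.
have [v vS [j jk pE]] := cover p.
by apply/imsetP; exists (v, Ordinal jk); rewrite ?inE ?vS.
Qed.

(** * Upper bounds from explicit sets *)

Lemma determining_multiples m : n <> 4%N -> (k < n)%N -> n <> k.*2 ->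
  (n <= m * k)%N -> (Det (PX n k) <= m)%N.
Proof.
move=> n4 kn nk nm.
pose g (j : 'I_m) : V := vertex (j * k)%N%:R xpred0.
have m_gt1 : (1 < m)%N.
  by rewrite ltnNge; apply/negP => m1; move: (leq_trans nm (leq_mul m1 (leqnn k)));
     rewrite mul1n leqNgt kn.
rewrite -[m in leqRHS]card_ord -cardsT; apply: leq_trans (leq_imset_card g _).
apply/Det_le/determining_cover => // [p|].
  have pm : (val p %/ k < m)%N.
    rewrite ltn_divLR //; apply: leq_trans nm.
    by rewrite val_Zp_lt.
  exists (g (Ordinal pm)); first exact: imset_f.
  exists (val p %% k)%N; first by rewrite ltn_mod.
  by rewrite -natrD -divn_eq natr_Zp.
exists (g (Ordinal (ltnW m_gt1))), (g (Ordinal m_gt1)).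
split; try exact: imset_f.
(* [2k] lies strictly between 0 and [2n] and differs from [n]. *)
rewrite /= mul0n addr0 mul1n eq_sym -natrD natr_Zp_eq0 // addnn.
apply/negP => /dvdnP[[|[|q]]] // e; first by move/eqP: e; rewrite double_eq0 gtn_eqF.
  by case: nk; rewrite e mul1n.
have : (k.*2 < n.*2)%N by rewrite ltn_double.
by rewrite e -mul2n ltn_pmul2r // ltnW.
Qed.

Lemma half_Det_le : n <> 4%N -> n = k.*2 -> (Det (PX n k) <= 3)%N.
Proof.
move=> n4 nk.
pose g (i : 'Z_n) : V := vertex i xpred0.
pose S := [set g 0; g k%:R; g 1].
have c3 : (#|S| <= 3)%N.
  by rewrite /S setUC cardsU1 cards2; case: (_ \notin _); case: (_ != _).
apply: leq_trans c3.
apply/Det_le/determining_cover => // [p|].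
  have [pk|kp] := ltnP (val p) k.
    exists (g 0); first by rewrite !inE eqxx.
    by exists (val p) => //; rewrite add0r natr_Zp.
  exists (g k%:R); first by rewrite !inE eqxx orbT.
  exists (val p - k)%N; last by rewrite -natrD subnKC // natr_Zp.
  rewrite ltn_subLR // addnn -nk.
  by rewrite val_Zp_lt.
(* The starts 0 and [k] have equal doubles here, so the pair uses 1. *)
exists (g 0), (g 1); rewrite !inE !eqxx ?orbT; split=> //=.
by rewrite addr0 eq_sym -(natrD _ 1 1) natr_Zp_eq0 // gtnNdvd.
Qed.

(** * Lower bound in the case [n = 2k] *)

Lemma half_cover_opposite (i i' : 'Z_n) : n = k.*2 ->
  (forall p : 'Z_n, exists2 v, v \in [:: i; i'] & exists2 j, (j < k)%N & p = v + j%:R) ->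
  i' = i + k%:R.
Proof.
move=> nk cover.
have small (d e : nat) : (d < n)%N -> (e < n)%N -> d%:R = e%:R :> 'Z_n -> d = e.
  by move=> dn en /(congr1 val); rewrite /= !val_Zp_nat // !modn_small.
have kn : (k < n)%N by rewrite nk -addnn -[ltnLHS]addn0 ltn_add2l.
have n_gt0 : (0 < n)%N by exact: ltnW.
pose d := val (i' - i).
have dn : (d < n)%N by rewrite val_Zp_lt.
have i'E : i' = i + d%:R by rewrite natr_Zp subrKC.
suff dk : d = k by rewrite i'E dk.
have [dk|kd|//] := ltngtP d k.
(* Overlapping intervals miss the position just before [i]. *)
- have [v] := cover (i + n.-1%:R); rewrite !inE => /orP[] /eqP ->.
    case=> j jk /addrI/small e; have : (n.-1 < k)%N by rewrite e ?ltn_predL // (ltn_trans jk).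
    by rewrite ltnNge -ltnS prednK // kn.
  case=> j jk; rewrite i'E -addrA -natrD => /addrI/small e.
  have djn: (d + j < n.-1)%N.
    rewrite nk -addnn -subn1 -addnBA // subn1 -addSn leq_add //.
    by rewrite -ltnS prednK.
  by move: (djn); rewrite e ?ltnn ?ltn_predL // (leq_trans djn) // leq_pred.
(* Here the gap after the first interval is missed. *)
- have [v] := cover (i + k%:R); rewrite !inE => /orP[] /eqP ->.
    by case=> j jk /addrI/small e; move: (jk); rewrite e ?ltnn // (ltn_trans jk).
  case=> j jk; rewrite i'E -addrA -natrD => /addrI.
  have [djn|ndj] := ltnP (d + j) n.
    by move=> /small e; move: kd; rewrite e // ltnNge leq_addr.
  rewrite -{1}(subnK ndj) natrD pchar_Zp // addr0 => /small e.
  have djk: (d + j - n < k)%N by rewrite ltn_subLR // -addSn leq_add // ltnW.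
  by move: (djk); rewrite -e ?ltnn // (ltn_trans djk).
Qed.

(* Two opposite intervals are each reversed by a common reflection; conjugating
   it by flips makes it fix any given pair of vertices lying over them. *)
Lemma half_determining_card (S : {set V}) : n = k.*2 ->
  determining (PX n k) S -> (2 < #|S|)%N.
Proof.
move=> nk detS; have cover := determining_covers detS.
have kn : (k < n)%N by rewrite nk -addnn -[ltnLHS]addn0 ltn_add2l.
have := determining_card detS; rewrite {1}nk -mul2n leq_pmul2r //.
rewrite leq_eqVlt => /orP[/eqP S2|//].
have /cards2P[u [v [_ SE]]] : #|S| == 2 by rewrite -S2.
have v1 : v.1 = u.1 + k%:R.
  apply: half_cover_opposite => // p.
  have [w wS pE] := cover p; exists w.1 => //.
  by move: wS; rewrite SE !inE => /orP[] /eqP ->; rewrite eqxx ?orbT.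
pose z i := vertex i xpred0.
(* The bits of [u] and [v] glued into one pattern on ['Z_n], so that [flip c] carries the all-zero
   vertices over their starts to them. *)
pose c p := let j := val (p - u.1) in
  if (j < k)%N then bit u j else bit v (j - k)%N.
have cE j : (j < n)%N -> c (u.1 + j%:R) = if (j < k)%N then bit u j else bit v (j - k)%N.
  move=> jn; have valj : val (j%:R : 'Z_n) = j by rewrite /= val_Zp_nat // modn_small.
  by rewrite /c [_ - u.1]addrC addKr valj.
have flip_u : flip c (z u.1) = u.
  rewrite permE; apply: vertex_ext => // j jk; rewrite !bit_vertex //=.
  by rewrite cE ?jk // (ltn_trans jk).
have flip_v : flip c (z v.1) = v.
  rewrite permE; apply: vertex_ext => // j jk; rewrite !bit_vertex //=.
  rewrite v1 -addrA -natrD cE; last by rewrite nk -addnn ltn_add2l.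
  by rewrite ltnNge leq_addr addKn.
(* This constant fixes the start [u.1], and also [u.1 + k] because [2k = 0]. *)
pose r := reflection (u.1 + u.1).
have rz i : r (z i) = z (u.1 + u.1 - i).
  rewrite permE; apply: eq_vertex => // j jk.
  by rewrite bit_vertex // (leq_ltn_trans (leq_subr _ _)) ?ltn_predL.
have r_u : r (z u.1) = z u.1 by rewrite rz addrK.
have r_v : r (z v.1) = z v.1.
  rewrite rz v1; congr z; rewrite opprD addrA addrK; congr (_ + _).
  by apply/eqP; rewrite eq_sym -addr_eq0 -natrD addnn -nk pchar_Zp.
have r1 : (r ^ flip c)%g = 1%g.
  apply: (determiningP _ _ detS).
    by rewrite !automorphismM ?automorphismV ?flip_aut ?reflection_aut.
  move=> w; rewrite SE !inE => /orP[] /eqP ->.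
    by rewrite -{1}flip_u permJ r_u flip_u.
  by rewrite -{1}flip_v permJ r_v flip_v.
(* [r] sends the start [u.1 + 1] to [u.1 - 1], which is different since 2 is nonzero. *)
have /permP/(_ (z (u.1 + 1))) : r = 1%g by apply/eqP; rewrite -(conjg_eq1 r (flip c)) r1.
rewrite rz perm1 => /(congr1 fst) /= /eqP.
rewrite -subr_eq0 (_ : _ - _ = - 2%:R); last by ring.
by rewrite oppr_eq0 natr_Zp_eq0 // gtnNdvd.
Qed.

End PraegerXu.

(** * Rational ceilings and the comparison of bounds *)

Lemma ceil_divr (n m k : nat) : (0 < k)%N -> (n <= m.+1 * k)%N -> (m * k < n)%N ->
  Num.ceil (n%:Q / k%:Q) = m.+1.
Proof.
move=> k0 nm mn; apply: ceil_def.
have k0Q : 0 < k%:Q by rewrite ltr0n.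
rewrite intS addrAC subrr add0r ltr_pdivlMr // ler_pdivrMr //.
by rewrite -intS -!intrM ltr_int ler_int -!PoszM ltz_nat lez_nat nm mn.
Qed.

Theorem theorem4p2 (n k : nat)
  (hn3 : (3 <= n)%N) (hn4 : n <> 4%N) (hk2 : (2 <= k)%N) (hkn : (k < n)%N) :
  (k%:Q <> n%:Q / 2%:Q ->
     (Det (PX n k))%:Z = Num.ceil (n%:Q / k%:Q)) /\
  (k%:Q = n%:Q / 2%:Q ->
     (Det (PX n k))%:Z = Num.ceil (n%:Q / k%:Q) + 1 /\
     Num.ceil (n%:Q / k%:Q) + 1 = 3%:Z).
Proof.
have k0 : (0 < k)%N by exact: ltnW.
have n0 : (0 < n)%N by exact: ltn_trans hkn.
have halfE : k%:Q = n%:Q / 2%:Q <-> n = k.*2.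
  have two_neq0 : 2%:Q != 0 by [].
  rewrite -mul2n; split=> [e|->]; last by rewrite PoszM intrM mulrC mulKf.
  have /intr_inj[//] : n%:Q = (2 * k)%N%:Q.
  by rewrite PoszM intrM e mulrC divfK.
split=> [/halfE nk|/halfE nk].
  (* Dividing [n - 1] makes [m.+1] the ceiling even when [k] divides [n]. *)
  pose m := (n.-1 %/ k)%N.
  have mn : (m * k < n)%N by rewrite -[ltnRHS]prednK // ltnS leq_trunc_div.
  have nm : (n <= m.+1 * k)%N by rewrite -{1}[n]prednK // ltn_ceil.
  rewrite (ceil_divr k0 nm mn); congr Posz; apply/eqP; rewrite eqn_leq.
  rewrite determining_multiples //=; apply: leq_Det => S /determining_card.
  by move=> /(_ hn3 hk2) nS; rewrite -(ltn_pmul2r k0) (leq_trans mn).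
have -> : Num.ceil (n%:Q / k%:Q) = 2.
  by apply: ceil_divr => //; rewrite ?mul1n // mul2n nk.
split=> //; congr Posz; apply/eqP; rewrite eqn_leq half_Det_le //=.
by apply: leq_Det => S; exact: half_determining_card.
Qed.
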